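(* Let $(X,\mathfrak B,\mu,T)$ and $(Y,\mathfrak C,\nu,S)$ be measure-preserving transformations of standard probability spaces, and suppose that they are isomorphic as measure-preserving systems. Then: (1) $(X,\mathfrak B,\mu,T)$ is measure-theoretically chaotic if and only if $(Y,\mathfrak C,\nu,S)$ is; (2) $(X,\mathfrak B,\mu,T)$ is uniformly measure-theoretically chaotic if and only if $(Y,\mathfrak C,\nu,S)$ is; (3) $(X,\mathfrak B,\mu,T)$ is measure-theoretically$^+$ chaotic if and only if $(Y,\mathfrak C,\nu,S)$ is; (4) $(X,\mathfrak B,\mu,T)$ is uniformly measure-theoretically$^+$ chaotic if and only if $(Y,\mathfrak C,\nu,S)$ is.
   Context: Isomorphism means a measurable (bimeasurable, measure-preserving) bijection between sets of full measure in $X$ and $Y$ intertwining the actions of $T$ and $S$. The upper density of an increasing sequence $(n_i)$ of positive integers is $\limsup_{N\to\infty}\frac1N\#\{i:n_i\le N\}$. Let $T$ be a measure-preserving transformation of a standard probability space $(X,\mathfrak B,\mu)$ ($\mathfrak B$ complete). A sequence $(\mathscr P_k)_{k\ge1}$ of finite measurable partitions is refining if $\mathscr P_{k+1}$ refines $\mathscr P_k$ for every $k$ and $\mathfrak B$ is the smallest complete sigma-algebra containing all the $\mathscr P_k$. A pair $(x,y)$ is $(\mathscr P_k)$-scrambled if (i) there is an increasing sequence $n_i$ of upper density 1 such that for every $k$ and all large enough $i$, $T^{n_i}x$ and $T^{n_i}y$ lie in the same atom of $\mathscr P_k$; and (ii) there are an increasing sequence $m_i$ of positive upper density and an index $k_0$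 such that for every $i$, $T^{m_i}x$ and $T^{m_i}y$ lie in different atoms of $\mathscr P_{k_0}$. A pair $(x,y)$ is $(\mathscr P_k)^+$-scrambled if (i) holds and (ii$^+$) for every $\eta\in(0,1)$ there are an increasing sequence $m_{\eta,i}$ of upper density at least $\eta$ and an index $k_\eta$ such that for every $i$, $T^{m_{\eta,i}}x$ and $T^{m_{\eta,i}}y$ lie in different atoms of $\mathscr P_{k_\eta}$. A set is $(\mathscr P_k)$-scrambled (resp. $(\mathscr P_k)^+$-scrambled) if every pair of its distinct elements is. A $(\mathscr P_k)$-scrambled set is uniformly scrambled if $k_0$ can be chosen common to all pairs of distinct elements and the upper densities of the sequences $m_i$ have a common positive lower bound $\eta$. A $(\mathscr P_k)^+$-scrambled set is uniformly scrambled if the function $\eta\mapsto k_\eta$ can be chosen common to all pairs of distinct elements. The system is measure-theoretically (uniformly measure-theoretically, measure-theoretically$^+$, uniformly measure-theoretically$^+$) chaotic if for every refining sequence of finite measurable partitions $(\mathscr P_k)$ there exists an uncountable $(\mathscr P_k)$-scrambled (uniformly $(\mathscr P_k)$-scrambled, $(\mathscr P_k)^+$-scrambled, uniformly $(\mathscr P_k)^+$-scrambled) set. *)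

(* Defs.v *)
From HB Require Import structures.
From mathcomp Require Import all_boot all_order all_algebra finmap.
From mathcomp Require Import all_classical all_reals all_analysis.

Set Implicit Arguments.
Unset Strict Implicit.
Unset Printing Implicit Defensive.

Import Order.TTheory GRing.Theory Num.Theory.
Import numFieldNormedType.Exports.

Local Open Scope classical_set_scope.
Local Open Scope ring_scope.

(** Measure-preserving systems *)

(* Here [phi] is a total function, but its values outside [X0] play no role. *)
Definition iso_mod0 d d' (R : realType) (X : measurableType d)
    (Y : measurableType d') (mu : {measure set X -> \bar R})
    (nu : {measure set Y -> \bar R}) (X0 : set X) (Y0 : set Y)
    (phi : X -> Y) : Prop :=
  [/\ measurable X0 /\ mu (~` X0) = 0%E,
      measurable Y0 /\ nu (~` Y0) = 0%E,
      set_bij X0 Y0 phi,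
      forall A, A `<=` X0 -> (measurable A <-> measurable (phi @` A)) &
      forall A, A `<=` X0 -> measurable A -> nu (phi @` A) = mu A].

(* A standard (Lebesgue-Rokhlin) probability space is a complete probability
   space that is isomorphic mod 0 to the completion of a Borel probability
   measure on the real line. *)
Definition standard_probability_space d (R : realType) (X : measurableType d)
    (mu : probability X R) : Prop :=
  measure_is_complete mu /\
  exists (m : probability (measurableTypeR R) R) X0 Y0 phi,
    iso_mod0 mu (@completed_measure_extension _ _ _ m) X0 Y0 phi.

Definition measure_preserving d (R : realType) (X : measurableType d)
    (mu : probability X R) (T : X -> X) : Prop :=
  measurable_fun setT T /\
  forall A, measurable A -> mu (T @^-1` A) = mu A.

(* [X0] need not be forward invariant, so the intertwining relation is required
   exactly at the points of [X0] at which both of its sides are meaningful. *)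
Definition isomorphic_systems d d' (R : realType) (X : measurableType d)
    (Y : measurableType d') (mu : probability X R) (nu : probability Y R)
    (T : X -> X) (S : Y -> Y) : Prop :=
  exists X0 Y0 phi, iso_mod0 mu nu X0 Y0 phi /\
    forall x, X0 x -> X0 (T x) -> phi (T x) = S (phi x).

(** Upper density *)

Definition pos_increasing (n : nat -> nat) : Prop :=
  (0 < n 0)%N /\ forall i, (n i < n i.+1)%N.

Definition upper_density (R : realType) (n : nat -> nat) : \bar R :=
  limn_esup (fun N : nat =>
    ((#|` fset_set [set i | (n i <= N)%N]|)%:R / N%:R : R)%:E).

(** Partitions, given by their sets of atoms *)

Definition finite_measurable_partition d (X : measurableType d)
    (P : set (set X)) : Prop :=
  [/\ finite_set P, P `<=` measurable & partition P id setT].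

Definition refines (X : Type) (Q P : set (set X)) : Prop :=
  forall A, Q A -> exists2 B, P B & A `<=` B.

(* Completeness of [G] is relative to the ambient measure: [G] contains every
   subset of every null measurable set. *)
Definition complete_sigma_algebra d (R : realType) (X : measurableType d)
    (mu : probability X R) (G : set (set X)) : Prop :=
  sigma_algebra setT G /\ mu.-negligible `<=` G.

Definition refining d (R : realType) (X : measurableType d)
    (mu : probability X R) (P : nat -> set (set X)) : Prop :=
  [/\ forall k, finite_measurable_partition (P k),
      forall k, refines (P k.+1) (P k) &
      smallest (complete_sigma_algebra mu) (\bigcup_k P k) = measurable].

Definition same_atom (X : Type) (P : set (set X)) (x y : X) : Prop :=
  exists A, [/\ P A, A x & A y].

Definition different_atoms (X : Type) (P : set (set X)) (x y : X) : Prop :=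
  exists A B, [/\ P A, P B, A <> B, A x & B y].

(** Scrambled pairs and sets *)

Definition separated_along (X : Type) (T : X -> X) (P : set (set X))
    (m : nat -> nat) (x y : X) : Prop :=
  forall i, different_atoms P (iter (m i) T x) (iter (m i) T y).

Definition synchronized (R : realType) (X : Type) (T : X -> X)
    (P : nat -> set (set X)) (x y : X) : Prop :=
  exists n, [/\ pos_increasing n, upper_density R n = 1%E &
    forall k, \forall i \near \oo,
      same_atom (P k) (iter (n i) T x) (iter (n i) T y)].

Definition scrambled_pair (R : realType) (X : Type) (T : X -> X)
    (P : nat -> set (set X)) (x y : X) : Prop :=
  synchronized R T P x y /\
  exists m k0, [/\ pos_increasing m, (0 < upper_density R m)%E &
    separated_along T (P k0) m x y].

Definition scrambled_pair_plus (R : realType) (X : Type) (T : X -> X)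
    (P : nat -> set (set X)) (x y : X) : Prop :=
  synchronized R T P x y /\
  forall eta : R, 0 < eta < 1 ->
    exists m k, [/\ pos_increasing m, (eta%:E <= upper_density R m)%E &
      separated_along T (P k) m x y].

Definition scrambled (R : realType) (X : Type) (T : X -> X)
    (P : nat -> set (set X)) (E : set X) : Prop :=
  forall x y, E x -> E y -> x <> y -> scrambled_pair R T P x y.

Definition scrambled_plus (R : realType) (X : Type) (T : X -> X)
    (P : nat -> set (set X)) (E : set X) : Prop :=
  forall x y, E x -> E y -> x <> y -> scrambled_pair_plus R T P x y.

Definition uniformly_scrambled (R : realType) (X : Type) (T : X -> X)
    (P : nat -> set (set X)) (E : set X) : Prop :=
  scrambled R T P E /\
  exists (k0 : nat) (eta : R), 0 < eta /\
    forall x y, E x -> E y -> x <> y ->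
      exists m, [/\ pos_increasing m, (eta%:E <= upper_density R m)%E &
        separated_along T (P k0) m x y].

Definition uniformly_scrambled_plus (R : realType) (X : Type) (T : X -> X)
    (P : nat -> set (set X)) (E : set X) : Prop :=
  scrambled_plus R T P E /\
  exists k : R -> nat,
    forall x y, E x -> E y -> x <> y -> forall eta : R, 0 < eta < 1 ->
      exists m, [/\ pos_increasing m, (eta%:E <= upper_density R m)%E &
        separated_along T (P (k eta)) m x y].

(** Chaos *)

Definition mt_chaotic d (R : realType) (X : measurableType d)
    (mu : probability X R) (T : X -> X) : Prop :=
  forall P, refining mu P ->
    exists E : set X, ~ countable E /\ scrambled R T P E.

Definition uniformly_mt_chaotic d (R : realType) (X : measurableType d)
    (mu : probability X R) (T : X -> X) : Prop :=
  forall P, refining mu P ->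
    exists E : set X, ~ countable E /\ uniformly_scrambled R T P E.

Definition mt_chaotic_plus d (R : realType) (X : measurableType d)
    (mu : probability X R) (T : X -> X) : Prop :=
  forall P, refining mu P ->
    exists E : set X, ~ countable E /\ scrambled_plus R T P E.

Definition uniformly_mt_chaotic_plus d (R : realType) (X : measurableType d)
    (mu : probability X R) (T : X -> X) : Prop :=
  forall P, refining mu P ->
    exists E : set X, ~ countable E /\ uniformly_scrambled_plus R T P E.

(* Main.v *)
Require Import Defs.
From mathcomp Require Import all_boot all_order all_algebra.
From mathcomp Require Import all_classical all_reals all_analysis.
From mathcomp Require Import finmap.

(** Chaos is tested against every refining sequence, so for the implication
from [X] to [Y] it is enough to pull a refining sequence [Q] of [Y] back to a
refining sequence [P] of [X] and to carry an uncountable [P]-scrambled set of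
[X] to a [Q]-scrambled set of [Y].  The difficulty is that a scrambled set is
an arbitrary uncountable set: it may well lie in the null set on which the
isomorphism [phi] says nothing, and that null set may have any cardinality.

The isomorphism is first restricted to the set [X0] of points whose whole
forward orbit stays where [phi] is meaningful.  This set has full measure and is
forward invariant, [phi] intertwines all iterates on it, and the situation
becomes symmetric in the two systems ([isomorphic_systems_conjugate],
[conjugate_sym]); so only one implication has to be proved.

The atoms of [P k] are the nonempty traces on [X0] of the preimages of the
atoms of [Q k], together with the complement of [X0] as one single atom.  Since
the complement is null, a complete sigma-algebra contains all its subsets, and
the pulled-back sequence is still refining ([refining_pullback]).  Since it is a
single atom, two points whose orbits never enter [X0] are never separated, so a
scrambled set contains at most one such point.  All its other points enter
[X0], and uncountably many of them are in [X0] at one common time [n].  On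
these, [x |-> phi (T^n x)] is injective, and its image is the wanted set
([orbit_transfer]): the orbits of the images follow those of the original points
with a delay of [n], and shifting a sequence of times by [n] does not decrease
its upper density ([upper_density_shift]).  Synchronization needs density
exactly 1, which survives because an upper density is at most 1.

The separating index [k] is not changed by this transport and the densities do
not decrease, so the plain, uniform and + versions of scrambling are all
inherited ([inherits_scrambling]). *)

Set Implicit Arguments.
Unset Strict Implicit.
Unset Printing Implicit Defensive.

Import Order.TTheory GRing.Theory Num.Theory.

Local Open Scope classical_set_scope.
Local Open Scope ring_scope.

(** * Upper density of delayed time sequences *)

Lemma le_limn_esup_eps (R : realType) (u v : (\bar R)^nat) :
  (forall e : R, 0 < e -> \forall N \near \oo, (u N <= v N + e%:E)%E) ->
  (limn_esup u <= limn_esup v)%E.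
Proof.
move=> uv; apply/lee_addgt0Pr => e e0; rewrite -leeBlDr//.
apply: le_ereal_inf_tmp => _ [V Voo <-]; rewrite leeBlDr//.
apply: ge_ereal_inf.
exists (ereal_sup (u @` (V `&` [set N | (u N <= v N + e%:E)%E]))).
  exists (V `&` [set N | (u N <= v N + e%:E)%E]) => //.
  by apply: filterI => //; exact: uv.
apply: ge_ereal_sup => _ [N [VN uvN] <-].
apply: (le_trans uvN); rewrite leeD2r//.
by apply: ereal_sup_ubound; exists N.
Qed.

Lemma pos_increasing_gt (m : nat -> nat) :
  pos_increasing m -> forall i, (i < m i)%N.
Proof.
move=> [m0 ms]; elim=> [//|i IH]; exact: leq_ltn_trans IH (ms i).
Qed.

Lemma pos_increasing_sub_II (m : nat -> nat) (N : nat) :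
  pos_increasing m -> [set i | (m i <= N)%N] `<=` `I_N.
Proof.
by move=> pm i /= miN; exact: leq_trans (pos_increasing_gt pm i) miN.
Qed.

Lemma finite_times (m : nat -> nat) (N : nat) :
  pos_increasing m -> finite_set [set i | (m i <= N)%N].
Proof.
by move=> pm; apply: sub_finite_set (finite_II N); exact: pos_increasing_sub_II.
Qed.

Lemma card_fset_set_II n : #|` fset_set `I_n| = n.
Proof. by apply: card_fset_set; exact: card_eqxx. Qed.

Lemma upper_density_le1 (R : realType) (m : nat -> nat) :
  pos_increasing m -> (upper_density R m <= 1)%E.
Proof.
move=> pm; apply: (@le_trans _ _ (ereal_sup (range (fun N : nat =>
    ((#|` fset_set [set i | (m i <= N)%N]|)%:R / N%:R : R)%:E)))).
  by apply: ereal_inf_lbound; exists setT => //; exact: filterT.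
apply: ge_ereal_sup => _ [N _ <-]; rewrite lee_fin.
have [->|N0] := posnP N; first by rewrite invr0 mulr0.
rewrite ler_pdivrMr ?ltr0n// mul1r ler_nat -[leqRHS]card_fset_set_II.
apply: fsubset_leq_card; rewrite -fset_set_sub//; last exact: finite_times.
exact: pos_increasing_sub_II.
Qed.

Definition shift_times (n : nat) (m : nat -> nat) (i : nat) : nat :=
  (m (n + i) - n)%N.

Lemma shift_timesK n m i : pos_increasing m ->
  (shift_times n m i + n)%N = m (n + i)%N.
Proof.
move=> pm; rewrite subnK//.
by rewrite (leq_trans _ (ltnW (pos_increasing_gt pm _)))// leq_addr.
Qed.

Lemma pos_increasing_shift n m : pos_increasing m ->
  pos_increasing (shift_times n m).
Proof.
move=> pm; have := pos_increasing_gt pm; case: (pm) => _ ms mgt; split.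
  by rewrite /shift_times subn_gt0 (leq_ltn_trans _ (mgt _))// leq_addr.
by move=> i; rewrite -(ltn_add2r n) !shift_timesK// addnS ms.
Qed.

(** The delayed sequence loses at most the [n] first terms of [m], which change
    the proportion of times up to [N] by at most [n / N]. *)
Lemma upper_density_shift (R : realType) n m : pos_increasing m ->
  (upper_density R m <= upper_density R (shift_times n m))%E.
Proof.
move=> pm; have ps := pos_increasing_shift n pm.
apply: le_limn_esup_eps => e e0.
have count N : (#|` fset_set [set i | (m i <= N)%N]| <=
    n + #|` fset_set [set i | (shift_times n m i <= N)%N]|)%N.
  set B := [set i | (shift_times n m i <= N)%N].
  have fB : finite_set B by exact: finite_times.
  apply: (@leq_trans #|` fset_set (`I_n `|` addn n @` B)|).
    apply: fsubset_leq_card; rewrite -fset_set_sub; last 2 first.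
    - exact: finite_times.
    - by rewrite finite_setU; split=> //; exact: finite_image.
    move=> i /= miN; have [ni|ni] := ltnP i n; [by left|right].
    exists (i - n)%N; last by rewrite subnKC.
    by rewrite /B/= /shift_times subnKC// (leq_trans (leq_subr _ _)).
  rewrite fset_setU//; last exact: finite_image.
  rewrite cardfsU (leq_trans (leq_subr _ _))// leq_add ?card_fset_set_II//.
  by rewrite fset_set_image// leq_imfset_card.
near=> N.
have N0 : (0 < N)%N by near: N; exact: nbhs_infty_gt.
rewrite -EFinD lee_fin ler_pdivrMr ?ltr0n// mulrDl divfK ?pnatr_eq0 -?lt0n//.
have nN : n%:R <= e * N%:R.
  rewrite mulrC -ler_pdivrMr//; near: N; exact: nbhs_infty_ger.
apply: le_trans (_ : (n + _)%:R <= _); first by rewrite ler_nat; exact: count.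
by rewrite natrD addrC lerD2l.
Unshelve. all: end_near.
Qed.

(** * Isomorphisms on forward-invariant sets *)

Section Conjugacy.
Context d d' (R : realType) (X : measurableType d) (Y : measurableType d').

Lemma iso_mod0_restrict (mu : probability X R) (nu : probability Y R)
    (X0 X1 : set X) (Y0 : set Y) (phi : X -> Y) :
  iso_mod0 mu nu X0 Y0 phi -> X1 `<=` X0 -> measurable X1 ->
  mu (~` X1) = 0%E -> iso_mod0 mu nu X1 (phi @` X1) phi.
Proof.
move=> [_ _ [_ inj _] mphi muphi] X10 mX1 X1full.
have mY1 : measurable (phi @` X1) by apply/(mphi _ X10).
have nuC : nu (~` (phi @` X1)) = mu (~` X1).
  by rewrite !probability_setC//; congr (1 - _)%E; exact: muphi.
split=> //.
- by split=> //; exact: etrans nuC X1full.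
- split; [by move=> x X1x; exists x| |by []].
  move=> x y /set_mem X1x /set_mem X1y; apply: inj; apply/mem_set; exact: X10.
- by move=> A AX1; apply: mphi => x /AX1 /X10.
- by move=> A AX1; apply: muphi => x /AX1 /X10.
Qed.

(** As [phi] maps [X0] onto [Y0], the hypothesis on [psi] determines it on [Y0]
    as the inverse of [phi]. *)
Lemma iso_mod0_sym (mu : probability X R) (nu : probability Y R)
    (X0 : set X) (Y0 : set Y) (phi : X -> Y) (psi : Y -> X) :
  iso_mod0 mu nu X0 Y0 phi ->
  (forall x, X0 x -> psi (phi x) = x) -> iso_mod0 nu mu Y0 X0 psi.
Proof.
move=> [[mX0 X0full] [mY0 Y0full] [hom inj surj] mphi muphi] psiK.
have psiE y : Y0 y -> X0 (psi y) /\ phi (psi y) = y.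
  by move=> /surj[x X0x <-]; rewrite psiK.
have psi_im B : B `<=` Y0 -> psi @` B `<=` X0 /\ phi @` (psi @` B) = B.
  move=> BY0; split; first by move=> _ [y /BY0 /psiE[? _] <-].
  apply/seteqP; split=> [_ [_ [y By <-] <-]|y By].
    by rewrite (psiE _ (BY0 _ By)).2.
  by exists (psi y); [exists y|rewrite (psiE _ (BY0 _ By)).2].
split=> //.
- split=> [y /psiE[]//|y y' /set_mem Yy /set_mem Yy' e|x X0x].
    by rewrite -(psiE _ Yy).2 e (psiE _ Yy').2.
  by exists (phi x); [exact: hom|exact: psiK].
- move=> B BY0; have [sub eqB] := psi_im B BY0.
  by rewrite -{1}eqB; split=> /(mphi _ sub).
- move=> B BY0 mB; have [sub eqB] := psi_im B BY0.
  by rewrite -[in RHS]eqB muphi//; apply/(mphi _ sub); rewrite eqB.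
Qed.

(** Unlike the intertwining relation of [isomorphic_systems], which is void at
    the points that [T] sends out of [X0], this relation passes to iterates and
    to the inverse of [phi]. *)
Definition conjugate_on (mu : probability X R) (nu : probability Y R)
    (T : X -> X) (S : Y -> Y) (X0 : set X) (Y0 : set Y) (phi : X -> Y) :=
  iso_mod0 mu nu X0 Y0 phi /\
  forall x, X0 x -> X0 (T x) /\ phi (T x) = S (phi x).

End Conjugacy.

Section ConjugacyTheory.
Context d d' (R : realType) (X : measurableType d) (Y : measurableType d').
Variables (mu : probability X R) (nu : probability Y R).
Variables (T : X -> X) (S : Y -> Y).

Lemma measurable_iter n : measurable_fun setT T ->
  measurable_fun setT (iter n T).
Proof.
move=> mT; elim: n => [|n IH]; first exact: measurable_id.
exact: (measurableT_comp mT IH).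
Qed.

(** The points whose forward orbit stays in the domain of the isomorphism form
    a countable intersection of preimages of that domain under the iterates of
    [T], each of full measure because [T] preserves the measure. *)
Lemma isomorphic_systems_conjugate : measure_preserving mu T ->
  isomorphic_systems mu nu T S ->
  exists X0 Y0 phi, conjugate_on mu nu T S X0 Y0 phi.
Proof.
move=> [mT muT] [X0 [Y0 [phi [iso inter]]]].
have [[mX0 X0full] _ _ _ _] := iso.
pose X1 := \bigcap_n (iter n T @^-1` X0).
have mpre n A : measurable A -> measurable (iter n T @^-1` A).
  by move=> mA; rewrite -[_ @^-1` _]setTI; exact: measurable_iter.
have X1T x : X1 x -> X1 (T x) by move=> X1x n _; rewrite /= -iterSr; exact: X1x.
have X10 : X1 `<=` X0 by move=> x /(_ 0%N I).
have mX1 : measurable X1 by apply: bigcapT_measurable => n; exact: mpre.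
exists X1, (phi @` X1), phi; split; last first.
  by move=> x /[dup] X1x /X1T X1Tx; split=> //; apply: inter; exact: X10.
apply: iso_mod0_restrict iso _ _ _ => //.
have pre0 n : mu (iter n T @^-1` (~` X0)) = 0%E.
  elim: n => [//|n IH].
  have -> : iter n.+1 T @^-1` (~` X0) = T @^-1` (iter n T @^-1` (~` X0)).
    by apply/seteqP; split=> x /=; rewrite -iterSr.
  by rewrite muT//; apply: mpre; exact: measurableC.
apply/negligibleP; first exact: measurableC.
rewrite setC_bigcap; apply: negligible_bigcup => n.
exists (iter n T @^-1` (~` X0)); split=> //; last exact: pre0.
by apply: mpre; exact: measurableC.
Qed.

Lemma iter_conjugate X0 Y0 phi : conjugate_on mu nu T S X0 Y0 phi ->
  forall n x, X0 x -> X0 (iter n T x) /\ phi (iter n T x) = iter n S (phi x).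
Proof.
move=> [_ inv] n x X0x; elim: n => [//|n [Xn en]].
by rewrite !iterS -en; exact: inv.
Qed.

Lemma conjugate_sym X0 Y0 phi : conjugate_on mu nu T S X0 Y0 phi ->
  exists psi, conjugate_on nu mu S T Y0 X0 psi.
Proof.
move=> [iso inv]; have [_ _ [hom inj surj] _ _] := iso.
have psiK x : X0 x -> pinv X0 phi (phi x) = x.
  by move=> X0x; apply: pinvKV => //; exact: mem_set.
exists (pinv X0 phi); split; first exact: iso_mod0_sym iso psiK.
move=> _ /surj[x X0x <-]; have [X0Tx e] := inv x X0x.
by rewrite -e !psiK//; split=> //; exact: hom.
Qed.

End ConjugacyTheory.

(** * Pulling back partitions *)

Lemma partition_not_different_atoms (X : Type) (P : set (set X)) x :
  partition P id setT -> ~ different_atoms P x x.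
Proof.
move=> [_ trivP _] [A [B [PA PB AB Ax Bx]]].
by apply: AB; apply: trivP => //; exists x.
Qed.

Section Pullback.
Context (X Y : Type) (D : set X) (phi : X -> Y).

(** The complement of [D] is kept as one atom: this is what prevents two orbits
    outside [D] from being separated.  Nonemptiness is required because an atom
    of [Q] may miss [phi @` D], and [D] may be the whole space. *)
Definition pullback_partition (Q : set (set Y)) : set (set X) :=
  [set A | A !=set0 /\
    ((exists2 B, Q B & A = D `&` phi @^-1` B) \/ A = ~` D)].

Lemma pullback_atom Q A x : pullback_partition Q A -> A x -> D x ->
  exists2 B, Q B & A = D `&` phi @^-1` B.
Proof. by move=> [_ [//|->]]. Qed.

Lemma same_atom_pullback Q x y : D x -> D y ->
  same_atom (pullback_partition Q) x y -> same_atom Q (phi x) (phi y).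
Proof.
move=> Dx Dy [A [QA Ax Ay]]; have [B QB AE] := pullback_atom QA Ax Dx.
by exists B; split=> //; [have := Ax|have := Ay]; rewrite AE => -[].
Qed.

Lemma different_atoms_pullback Q x y : D x -> D y ->
  different_atoms (pullback_partition Q) x y ->
  different_atoms Q (phi x) (phi y).
Proof.
move=> Dx Dy [A [A' [QA QA' AA' Ax A'y]]].
have [B QB AE] := pullback_atom QA Ax Dx.
have [B' QB' AE'] := pullback_atom QA' A'y Dy.
exists B, B'; split=> //.
- by move=> BB'; apply: AA'; rewrite AE AE' BB'.
- by move: Ax; rewrite AE => -[].
- by move: A'y; rewrite AE' => -[].
Qed.

Lemma pullback_out Q A x : pullback_partition Q A -> A x -> ~ D x -> A = ~` D.
Proof. by move=> [_ [[B _ ->] [//]|//]]. Qed.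

Lemma not_different_atoms_out Q x y : ~ D x -> ~ D y ->
  ~ different_atoms (pullback_partition Q) x y.
Proof.
move=> nDx nDy [A [A' [QA QA' AA' Ax A'y]]]; apply: AA'.
by rewrite (pullback_out QA Ax nDx) (pullback_out QA' A'y nDy).
Qed.

Lemma partition_pullback Q :
  partition Q id setT -> partition (pullback_partition Q) id setT.
Proof.
move=> [covQ trivQ neQ]; split.
- apply/seteqP; split=> // x _.
  have [Dx|nDx] := pselect (D x); last first.
    by exists (~` D) => //; split; [exists x|right].
  have [B QB Bx] : cover Q id (phi x) by rewrite covQ.
  exists (D `&` phi @^-1` B) => //; split; [by exists x|left; by exists B].
- move=> A A' QA QA' [x [/= Ax A'x]].
  have [Dx|nDx] := pselect (D x); last first.
    by rewrite (pullback_out QA Ax nDx) (pullback_out QA' A'x nDx).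
  have [B QB AE] := pullback_atom QA Ax Dx.
  have [B' QB' AE'] := pullback_atom QA' A'x Dx.
  rewrite AE AE'; congr (_ `&` _ @^-1` _); apply: trivQ => //.
  by exists (phi x); move: Ax A'x; rewrite AE AE' => -[_ Bx] [_ B'x].
- by move=> A [].
Qed.

Lemma refines_pullback Q Q' : refines Q' Q ->
  refines (pullback_partition Q') (pullback_partition Q).
Proof.
move=> ref A [[x Ax] [[B QB AE]|AE]]; last first.
  by exists A => //; split; [exists x|right].
have [B' QB' BB'] := ref B QB; exists (D `&` phi @^-1` B'); last first.
  by rewrite AE => z [Dz /BB'].
split; last by left; exists B'.
by exists x; move: Ax; rewrite AE => -[Dx /BB'].
Qed.

Lemma finite_pullback Q : finite_set Q -> finite_set (pullback_partition Q).
Proof.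
move=> finQ; apply: (@sub_finite_set _ _
  ((fun B => D `&` phi @^-1` B) @` Q `|` [set ~` D])).
  by move=> A [_ [[B QB ->]|->]]; [left; exists B|right].
by rewrite finite_setU; split; [exact: finite_image|exact: finite_set1].
Qed.

End Pullback.

(** * Inheritance of scrambling *)

Section Scrambling.
Context (R : realType) (X Y : Type) (T : X -> X) (S : Y -> Y).
Implicit Types (P : nat -> set (set X)) (Q : nat -> set (set Y)).

Definition pairwise_separated P (E : set X) := forall x y, E x -> E y ->
  x <> y -> exists m k, pos_increasing m /\ separated_along T (P k) m x y.

Lemma scrambled_separated P E : scrambled R T P E -> pairwise_separated P E.
Proof.
move=> scE x y Ex Ey xy.
by have [_ [m [k [pm _ sep]]]] := scE x y Ex Ey xy; exists m, k.
Qed.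

Lemma scrambled_plus_separated P E :
  scrambled_plus R T P E -> pairwise_separated P E.
Proof.
move=> scE x y Ex Ey xy.
have half : 0 < (2^-1 : R) < 1 by rewrite invr_gt0 ltr0n/= invf_lt1 ?ltr1n.
have [_ /(_ _ half)[m [k [pm _ sep]]]] := scE x y Ex Ey xy.
by exists m, k.
Qed.

(** What the transport of a scrambled set preserves, in a form that serves the
    four notions of scrambling at once: the index [k] is the same on both sides,
    which gives the uniform versions. *)
Definition inherits_scrambling P Q (E : set X) (F : set Y) :=
  forall u v, F u -> F v -> u <> v -> exists x y,
    [/\ E x, E y, x <> y,
        synchronized R T P x y -> synchronized R S Q u v &
        forall m k, pos_increasing m -> separated_along T (P k) m x y ->
          exists m', [/\ pos_increasing m',
            (upper_density R m <= upper_density R m')%E &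
            separated_along S (Q k) m' u v]].

Variables (P : nat -> set (set X)) (Q : nat -> set (set Y)).
Variables (E : set X) (F : set Y).
Hypothesis EF : inherits_scrambling P Q E F.

Lemma inherits_scrambled : scrambled R T P E -> scrambled R S Q F.
Proof.
move=> scE u v Fu Fv uv.
have [x [y [Ex Ey xy sync sep]]] := EF Fu Fv uv.
have [sxy [m [k [pm dm sm]]]] := scE x y Ex Ey xy; split; first exact: sync.
have [m' [pm' mm' sm']] := sep m k pm sm.
by exists m', k; split=> //; exact: lt_le_trans mm'.
Qed.

Lemma inherits_scrambled_plus :
  scrambled_plus R T P E -> scrambled_plus R S Q F.
Proof.
move=> scE u v Fu Fv uv.
have [x [y [Ex Ey xy sync sep]]] := EF Fu Fv uv.
have [sxy sep_eta] := scE x y Ex Ey xy; split; first exact: sync.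
move=> eta /sep_eta[m [k [pm dm sm]]].
have [m' [pm' mm' sm']] := sep m k pm sm.
by exists m', k; split=> //; exact: le_trans mm'.
Qed.

Lemma inherits_uniformly_scrambled :
  uniformly_scrambled R T P E -> uniformly_scrambled R S Q F.
Proof.
move=> [scE [k [eta [eta0 unif]]]]; split; first exact: inherits_scrambled.
exists k, eta; split=> // u v Fu Fv uv.
have [x [y [Ex Ey xy _ sep]]] := EF Fu Fv uv.
have [m [pm dm sm]] := unif x y Ex Ey xy.
have [m' [pm' mm' sm']] := sep m k pm sm.
by exists m'; split=> //; exact: le_trans mm'.
Qed.

Lemma inherits_uniformly_scrambled_plus :
  uniformly_scrambled_plus R T P E -> uniformly_scrambled_plus R S Q F.
Proof.
move=> [scE [k unif]]; split; first exact: inherits_scrambled_plus.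
exists k => u v Fu Fv uv eta eta01.
have [x [y [Ex Ey xy _ sep]]] := EF Fu Fv uv.
have [m [pm dm sm]] := unif x y Ex Ey xy eta eta01.
have [m' [pm' mm' sm']] := sep m (k eta) pm sm.
by exists m'; split=> //; exact: le_trans mm'.
Qed.

End Scrambling.

(** * Transport of refining sequences and scrambled sets *)

Section Transfer.
Context d d' (R : realType) (X : measurableType d) (Y : measurableType d').
Variables (mu : probability X R) (nu : probability Y R).

(** For the generation property, let [G] be a complete sigma-algebra containing
    the pulled-back atoms.  The sets whose pulled-back trace belongs to [G] form
    a complete sigma-algebra on [Y] that contains all atoms of [Q], hence all
    measurable sets; and a measurable subset of [X] is, up to a null set, the
    pullback of the image of its part in [X0]. *)
Lemma refining_pullback (X0 : set X) (Y0 : set Y) phi Q :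
  measure_is_complete mu -> iso_mod0 mu nu X0 Y0 phi ->
  refining nu Q -> refining mu (fun k => pullback_partition X0 phi (Q k)).
Proof.
move=> cmu [[mX0 X0full] [mY0 _] [hom inj surj] mphi muphi] [finQ refQ genQ].
have phi_pre B : phi @` (X0 `&` phi @^-1` B) = B `&` Y0.
  apply/seteqP; split=> [_ [x [X0x Bx] <-]|y [By /surj[x X0x xy]]].
    by split=> //; exact: hom.
  by exists x => //; split=> //=; rewrite xy.
have mpre B : measurable B -> measurable (X0 `&` phi @^-1` B).
  move=> mB; apply/mphi; first by move=> x [].
  by rewrite phi_pre; exact: measurableI.
split.
- move=> k; have [fQ mQ pQ] := finQ k; split.
  + exact: finite_pullback.
  + move=> A [_ [[B QB ->]|->]]; last exact: measurableC.
    by apply: mpre; exact: mQ.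
  + exact: partition_pullback.
- by move=> k; exact: refines_pullback.
apply/seteqP; split=> [A|A mA G [[[G0 GC GU] Gneg] GP]].
  apply; split; last first.
    move=> B [k _ [_ [[C QC ->]|->]]]; last exact: measurableC.
    by apply: mpre; have [_ mQ _] := finQ k; exact: mQ.
  split; last exact: cmu.
  by split=> //; [move=> B mB; exact: measurableD|exact: bigcupT_measurable].
have GCs B : G B -> G (~` B) by move=> /GC; rewrite setTD.
have GUs B C : G B -> G C -> G (B `|` C).
  move=> GB GC'; rewrite -bigcup2E; apply: GU => n.
  by rewrite /bigcup2; case: n => [|[|n]]//=.
have GX0C : G (~` X0).
  by apply: Gneg; exists (~` X0); split=> //; exact: measurableC.
have GX0 : G X0 by rewrite -(setCK X0); exact: GCs.
have GI B C : G B -> G C -> G (B `&` C).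
  by move=> GB GC'; rewrite -[_ `&` _]setCK setCI; apply/GCs/GUs; exact: GCs.
(* [H] contains the null sets of [Y] because [phi] preserves measure. *)
pose H := [set B : set Y | G (X0 `&` phi @^-1` B)].
have sH : measurable `<=` H.
  rewrite -genQ; apply: smallest_sub.
    split; first split.
    - by rewrite /H/= preimage_set0 setI0.
    - move=> B HB; rewrite /H/= setTD.
      have -> : X0 `&` phi @^-1` (~` B) = X0 `&` ~` (X0 `&` phi @^-1` B).
        apply/seteqP; split=> x /= [X0x nB]; split=> // Bx; apply: nB => //.
        by case: Bx.
      by apply: GI => //; exact: GCs.
    - move=> F HF; rewrite /H/= preimage_bigcup setI_bigcupr; exact: GU.
    move=> B [C [mC C0 BC]]; apply: Gneg.
    exists (X0 `&` phi @^-1` C); split; first exact: mpre.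
      rewrite -muphi//; last exact: mpre.
      rewrite phi_pre; apply: (subset_measure0 _ _ _ C0) => //.
      exact: measurableI.
    by move=> x [X0x /BC].
  (* An empty trace is not an atom of the pullback, but it belongs to [G]. *)
  move=> B [k _ QB]; have [e0|/set0P ne0] := eqVneq (X0 `&` phi @^-1` B) set0.
    by rewrite /H/= e0.
  by apply: GP; exists k => //; split=> //; left; exists B.
have -> : A = (X0 `&` phi @^-1` (phi @` (A `&` X0))) `|` (A `&` ~` X0).
  apply/seteqP; split=> [x Ax|x [[X0x [z [Az X0z] e]]|[]//]].
    by have [X0x|nX0x] := pselect (X0 x); [left; split=> //; exists x|right].
  by rewrite -(inj z x)//; exact: mem_set.
apply: GUs; first by apply: sH; apply/mphi => //; exact: measurableI.
by apply: Gneg; exists (~` X0); split=> //; exact: measurableC.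
Qed.

(** The image is taken at a common time [n] at which uncountably many points of
    [E] are in [X0].  Distinct points of [E] cannot have merged by then, as
    their orbits are separated at arbitrarily late times. *)
Lemma orbit_transfer (T : X -> X) (S : Y -> Y) (X0 : set X) (Y0 : set Y) phi Q
    (P := fun k : nat => pullback_partition X0 phi (Q k)) (E : set X) :
  conjugate_on mu nu T S X0 Y0 phi ->
  (forall k, partition (Q k) id setT) -> ~ countable E ->
  pairwise_separated T P E ->
  exists F : set Y, ~ countable F /\ inherits_scrambling R T S P Q E F.
Proof.
move=> conj partQ ncE sepE; have it := iter_conjugate conj.
have [[_ _ [hom inj surj] _ _] inv] := conj.
pose En n := E `&` iter n T @^-1` X0.
have [n ncEn] : exists n, ~ countable (En n).
  apply/not_existsP => cEn; apply: ncE.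
  (* [Einf] has at most one point: its orbits stay in a single atom. *)
  pose Einf := [set x | E x /\ forall n, ~ X0 (iter n T x)].
  have cinf : countable Einf.
    have [->|/set0P[x Ex]] := eqVneq Einf set0; first exact: countable0.
    apply: (sub_countable _ (countable1 x)); apply: subset_card_le.
    move=> y Ey /=; apply: contrapT => yx.
    have [m [k [_ /(_ 0%N)]]] := sepE y x Ey.1 Ex.1 yx.
    by apply: not_different_atoms_out; [exact: Ey.2|exact: Ex.2].
  apply: (@sub_countable _ _ _ (\bigcup_k if k is n.+1 then En n else Einf)).
    apply: subset_card_le => x Ex.
    have [[n Xn]|nX] := pselect (exists n, X0 (iter n T x)).
      by exists n.+1.
    by exists 0%N => //; split=> // n Xn; apply: nX; exists n.
  apply: bigcup_countable => [//|[|n] _ //].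
  by apply: contrapT; exact: cEn.
pose f x := phi (iter n T x).
have shifted m x : pos_increasing m -> En n x -> forall i,
    iter (m (n + i)%N) T x = iter (shift_times n m i) T (iter n T x).
  by move=> pm _ i; rewrite -iterD shift_timesK.
have Tinj x y : En n x -> En n y -> iter n T x = iter n T y -> x = y.
  move=> Ex Ey e; apply: contrapT => xy.
  have [m [k [pm sep]]] := sepE x y Ex.1 Ey.1 xy.
  have := sep (n + 0)%N; rewrite (shifted _ _ pm Ex) (shifted _ _ pm Ey) e.
  by apply: partition_not_different_atoms; apply: partition_pullback.
have finj : {in En n &, injective f}.
  move=> x y /set_mem Ex /set_mem Ey fxy; apply: Tinj => //.
  by apply: inj fxy; apply/mem_set; [exact: Ex.2|exact: Ey.2].
exists (f @` En n); split.
  by rewrite (eq_countable (inj_card_eq finj)).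
move=> _ _ [x Ex <-] [y Ey <-] fxy; exists x, y; split.
- exact: Ex.1.
- exact: Ey.1.
- by move=> xy; apply: fxy; rewrite xy.
- move=> [m [pm dm same]]; exists (shift_times n m); split.
  + exact: pos_increasing_shift.
  + apply/eqP.
    rewrite eq_le (upper_density_le1 _ (pos_increasing_shift n pm))/=.
    by rewrite -[X in (X <= _)%E]dm upper_density_shift.
  + move=> k; have [M _ MP] := same k; exists M => // i /= Mi.
    have /= := MP (n + i)%N (leq_trans Mi (leq_addl _ _)).
    rewrite (shifted _ _ pm Ex) (shifted _ _ pm Ey).
    have [Xx ex] := it (shift_times n m i) _ Ex.2.
    have [Xy ey] := it (shift_times n m i) _ Ey.2.
    by rewrite -ex -ey; exact: same_atom_pullback.
- move=> m k pm sep; exists (shift_times n m); split.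
  + exact: pos_increasing_shift.
  + exact: upper_density_shift.
  + move=> i; have := sep (n + i)%N.
    rewrite (shifted _ _ pm Ex) (shifted _ _ pm Ey).
    have [Xx ex] := it (shift_times n m i) _ Ex.2.
    have [Xy ey] := it (shift_times n m i) _ Ey.2.
    by rewrite -ex -ey; exact: different_atoms_pullback.
Qed.

(** [scrX] and [scrY] stand for the same notion of scrambling in the two
    systems. *)
Lemma chaos_transfer T S X0 Y0 phi
    (scrX : (nat -> set (set X)) -> set X -> Prop)
    (scrY : (nat -> set (set Y)) -> set Y -> Prop) :
  measure_is_complete mu -> conjugate_on mu nu T S X0 Y0 phi ->
  (forall P E, scrX P E -> pairwise_separated T P E) ->
  (forall P Q E F, inherits_scrambling R T S P Q E F -> scrX P E -> scrY Q F) ->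
  (forall P, refining mu P -> exists E, ~ countable E /\ scrX P E) ->
  forall Q, refining nu Q -> exists F, ~ countable F /\ scrY Q F.
Proof.
move=> cmu conj sepX inh chX Q refQ.
have [E [ncE scE]] := chX _ (refining_pullback cmu conj.1 refQ).
have partQ k : partition (Q k) id setT by have [/(_ k)[]] := refQ.
have [F [ncF EF]] := orbit_transfer conj partQ ncE (sepX _ _ scE).
by exists F; split=> //; exact: inh EF scE.
Qed.

Lemma chaos_conjugate T S X0 Y0 phi :
  measure_is_complete mu -> conjugate_on mu nu T S X0 Y0 phi ->
  [/\ mt_chaotic mu T -> mt_chaotic nu S,
      uniformly_mt_chaotic mu T -> uniformly_mt_chaotic nu S,
      mt_chaotic_plus mu T -> mt_chaotic_plus nu S &
      uniformly_mt_chaotic_plus mu T -> uniformly_mt_chaotic_plus nu S].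
Proof.
move=> cmu conj; split; apply: (chaos_transfer cmu conj).
- by move=> P E; exact: scrambled_separated.
- by move=> P Q E F; exact: inherits_scrambled.
- by move=> P E [+ _]; exact: scrambled_separated.
- by move=> P Q E F; exact: inherits_uniformly_scrambled.
- by move=> P E; exact: scrambled_plus_separated.
- by move=> P Q E F; exact: inherits_scrambled_plus.
- by move=> P E [+ _]; exact: scrambled_plus_separated.
- by move=> P Q E F; exact: inherits_uniformly_scrambled_plus.
Qed.

End Transfer.

Theorem theorem1 (R : realType) (d d' : measure_display)
    (X : measurableType d) (Y : measurableType d')
    (mu : probability X R) (nu : probability Y R)
    (T : X -> X) (S : Y -> Y)
    (stdX : standard_probability_space mu)
    (stdY : standard_probability_space nu)
    (mpT : measure_preserving mu T)
    (mpS : measure_preserving nu S)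
    (isoXY : isomorphic_systems mu nu T S) :
  [/\ mt_chaotic mu T <-> mt_chaotic nu S,
      uniformly_mt_chaotic mu T <-> uniformly_mt_chaotic nu S,
      mt_chaotic_plus mu T <-> mt_chaotic_plus nu S &
      uniformly_mt_chaotic_plus mu T <-> uniformly_mt_chaotic_plus nu S].
Proof.
have [X0 [Y0 [phi conj]]] := isomorphic_systems_conjugate mpT isoXY.
have [psi conj'] := conjugate_sym conj.
have [c1 c2 c3 c4] := chaos_conjugate stdX.1 conj.
by have [c1' c2' c3' c4'] := chaos_conjugate stdY.1 conj'.
Qed.
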